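(* For all integers $n\ge 0$ and $s\ge 1$, $$a_{n,s}=\sum_{k=0}^{s-1}\binom{n+k}{k}\,y_{n,s-k-1},$$ and conversely, for all integers $n\ge 0$ and $k\ge 0$, $$y_{n,k}=\sum_{j=1}^{k+1}(-1)^{k-j+1}\binom{n+1}{k-j+1}\,a_{n,j}.$$
   Context: A semistandard Young tableau on $s$ symbols of shape $\lambda$ (a Ferrers diagram) is a filling of the cells of $\lambda$ with integers in $\{1,\dots,s\}$ (not necessarily all used), strictly increasing along rows and weakly increasing down columns; $a_{n,s}$ denotes the number of semistandard Young tableaux with $n$ cells on $s$ symbols. A reverse Yamanouchi word is a word $w=w_1\cdots w_n$ with positive integer entries such that for every prefix $w_1\cdots w_m$ and every $i\ge1$, the number of occurrences of $i+1$ in the prefix does not exceed the number of occurrences of $i$. The descent set of a word $w$ is $\{1\le i<n: w_i\ge w_{i+1}\}$, and $d(w)$ is its cardinality. $y_{n,k}$ denotes the number of reverse Yamanouchi words of length $n$ with exactly $k$ descents (so $y_{n,k}=0$ when $k\ge n$ and $n\ge 1$). *)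

(* Defs.v *)
From mathcomp Require Import all_boot.

Set Implicit Arguments.
Unset Strict Implicit.
Unset Printing Implicit Defensive.

(* A partition of n, padded with zeros to exactly n parts: a partition of n    *)
(* has at most n nonzero parts, each of them at most n.                        *)
Definition is_partition (n : nat) (la : {ffun 'I_n -> 'I_n.+1}) : bool :=
  [forall i : 'I_n, forall j : 'I_n, (i <= j) ==> (la j <= la i)]
    && (\sum_(i < n) la i == n).

(* Cells are pairs (row, column), both numbered from 0. *)
Definition diagram (n : nat) (la : {ffun 'I_n -> 'I_n.+1}) :
    {set 'I_n * 'I_n} :=
  [set c : 'I_n * 'I_n | c.2 < la c.1].

Definition cell (n : nat) (la : {ffun 'I_n -> 'I_n.+1}) : finType :=
  {c : 'I_n * 'I_n | c \in diagram la}.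

(* The symbols 1, ..., s are represented by the elements 0, ..., s - 1 of 'I_s *)
(* (only their order matters). Rows increase strictly, columns weakly.         *)
Definition semistandard (n : nat) (la : {ffun 'I_n -> 'I_n.+1}) (s : nat)
    (T : {ffun cell la -> 'I_s}) : bool :=
  [forall c : cell la, forall d : cell la,
     (((val c).1 == (val d).1) && ((val c).2 < (val d).2) ==> (T c < T d))
  && (((val c).2 == (val d).2) && ((val c).1 < (val d).1) ==> (T c <= T d))].

(* a_{n,s} *)
Definition num_ssyt (n s : nat) : nat :=
  \sum_(la : {ffun 'I_n -> 'I_n.+1} | is_partition la)
     #|[set T : {ffun cell la -> 'I_s} | semistandard T]|.

(* The bounds on m and i only serve decidability, see reverse_yamanouchiP. *)
Definition reverse_yamanouchi (w : seq nat) : bool :=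
  all (fun x => 0 < x) w &&
  all (fun m =>
         all (fun i => count_mem i.+1 (take m w) <= count_mem i (take m w))
             (iota 1 (\max_(x <- w) x)))
      (iota 0 (size w).+1).

Lemma reverse_yamanouchiP (w : seq nat) :
  reflect ((forall x, x \in w -> 1 <= x) /\
           (forall m i, 1 <= i ->
              count_mem i.+1 (take m w) <= count_mem i (take m w)))
          (reverse_yamanouchi w).
Proof.
apply: (iffP andP) => [[/allP pos /allP yam]|[pos yam]]; split=> //.
- move=> m i i_gt0.
  wlog le_mw : m / m <= size w => [wl|].
    case: (leqP m (size w)) => [/wl //|/ltnW lt_wm].
    by rewrite take_oversize // -(take_size w); apply: wl.
  have m_in : m \in iota 0 (size w).+1 by rewrite mem_iota add0n ltnS.
  have /allP yam_m := yam _ m_in.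
  case: (leqP i (\max_(x <- w) x)) => [le_i|gt_i].
    by apply: yam_m; rewrite mem_iota i_gt0 add1n ltnS.
  suff /count_memPn -> : i.+1 \notin take m w by [].
  apply/negP => /mem_take i_in.
  have := @leq_bigmax_seq _ w xpredT id _ i_in isT.
  by rewrite leqNgt ltnS (ltnW gt_i).
- exact/allP.
- apply/allP => m _; apply/allP => i; rewrite mem_iota => /andP[i_gt0 _].
  exact: yam.
Qed.

(* No word is lost by taking the letters in 'I_n.+1 in num_yamanouchi. *)
Lemma reverse_yamanouchi_le_size (w : seq nat) :
  reverse_yamanouchi w -> forall x, x \in w -> x <= size w.
Proof.
move/reverse_yamanouchiP=> [pos yam] x x_in.
have all_in i : 1 <= i <= x -> i \in w.
  move=> /andP[i_gt0 le_ix].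
  rewrite -(subKn le_ix) in i_gt0 *.
  have : x - i <= x by apply: leq_subr.
  elim: (x - i) i_gt0 => [|k IHk] pos_k le_kx; first by rewrite subn0.
  have lt_kx : k < x by [].
  have := yam (size w) _ pos_k; rewrite take_size -subSn // subSS => le_c.
  rewrite -has_pred1 has_count; apply: leq_trans le_c.
  by rewrite -has_count has_pred1 IHk ?subn_gt0 // ltnW.
rewrite -[x in x <= _](size_iota 1); apply: uniq_leq_size (iota_uniq _ _) _.
by move=> i; rewrite mem_iota add1n ltnS => /all_in.
Qed.

(* Positions are numbered from 1: w_i is nth 0 w i.-1. *)
Definition descent_set (w : seq nat) : seq nat :=
  [seq i <- iota 1 (size w).-1 | nth 0 w i.-1 >= nth 0 w i].

(* y_{n,k} *)
Definition num_yamanouchi (n k : nat) : nat :=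
  #|[set w : n.-tuple 'I_n.+1 |
       reverse_yamanouchi (map val w) && (size (descent_set (map val w)) == k)]|.

(* Main.v *)
Require Import Defs.
From mathcomp Require Import all_boot all_order all_algebra.
From mathcomp Require Import zify.

(* Record a tableau by the pairs (entry, row) of its cells. Rows being strict,
   these are n distinct pairs, so the tableau is determined by its shape and
   the lexicographically increasing list (c_1, w_1), ..., (c_n, w_n). Columns
   are weakly increasing iff w is a reverse Yamanouchi word, and the list is
   lexicographically increasing iff c is weakly increasing with a strict step
   at each descent of w. For a fixed w with d descents there are
   C(n + s - 1 - d, n) such sequences c, which gives the first formula. On
   generating functions it is multiplication by x / (1 - x)^(n + 1); inverting
   it gives the second one. *)

Set Implicit Arguments.
Unset Strict Implicit.
Unset Printing Implicit Defensive.

(** * Counting the admissible entry sequences of a fixed word *)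

Lemma sum_tuple_cons (T : finType) n (F : n.+1.-tuple T -> nat) :
  \sum_t F t = \sum_x \sum_(t : n.-tuple T) F [tuple of x :: t].
Proof.
rewrite pair_big /= (reindex (fun p : T * n.-tuple T => [tuple of p.1 :: p.2])) //=.
exists (fun t => (thead t, [tuple of behead t])) => [[x t] _|t _] /=.
  by congr (_, _); apply: val_inj.
by rewrite [RHS]tuple_eta; apply: val_inj.
Qed.

(* The lexicographic order: [y.1] must exceed [x.1] strictly exactly when the
   second components form a descent. *)
Definition lex_lt (x y : nat * nat) : bool := x.1 + (y.2 <= x.2) <= y.1.

Lemma lex_lt_irr : irreflexive lex_lt.
Proof. by move=> x; rewrite /lex_lt; lia. Qed.

Lemma lex_lt_trans : transitive lex_lt.
Proof. by move=> y x z; rewrite /lex_lt; lia. Qed.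

(** Pascal's rule, by induction on [N]. As [d <= n], the subtractions never truncate, and the terms
    with [u < d] vanish. *)
Lemma hockey_stick n d N : d <= n ->
  \sum_(u < N) 'C(n + u - d, n) = 'C(n + N - d, n.+1).
Proof.
move=> le_dn; elim: N => [|N IHN].
  by rewrite big_ord0 bin_small //; lia.
rewrite big_ord_recr /= IHN.
have -> : n + N.+1 - d = (n + N - d).+1 by lia.
by rewrite binS.
Qed.

(** Induction on [w]: the first symbol [v] satisfies [lo + b <= v < hi], where [b] tells whether the
    step from [p] to [x] is a descent, and the possible tails for each [v] add up along a hockey
    stick. *)
Lemma card_lex_chains (w : seq nat) hi lo p : lo < hi ->
  \sum_(c : (size w).-tuple 'I_hi) path lex_lt (lo, p) (zip (map val c) w) =
  'C(size w + hi - lo.+1 - count id (pairmap geq p w), size w).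
Proof.
elim: w lo p => [|x w IHw] lo p lt_lo.
  rewrite bin0 (eq_bigr (fun=> 1)) => [|c _]; last by rewrite [c]tuple0.
  by rewrite sum1_card card_tuple expn0.
rewrite sum_tuple_cons /=.
set d := count id _; set b : nat := x <= p.
have le_d : d <= size w.
  by rewrite -(size_pairmap geq x w) count_size.
have -> : \sum_(v < hi) \sum_(c : (size w).-tuple 'I_hi)
     (lex_lt (lo, p) (val v, x) && path lex_lt (val v, x) (zip (map val c) w) : nat) =
  \sum_(v < hi | lo + b <= v) 'C(size w + (hi - v.+1) - d, size w).
  rewrite [RHS]big_mkcond; apply: eq_bigr => v _; rewrite /lex_lt /= -/b.
  case: ifP => _; last by rewrite big1.
  rewrite IHw // -/d; congr 'C(_, _); have := ltn_ord v; lia.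
(* Reversing the range turns [lo + b <= v] into the initial segment [u < hi - lo - b]. *)
rewrite (reindex_inj rev_ord_inj) /=.
rewrite (eq_big (fun u : 'I_hi => u < hi - lo - b)
   (fun u : 'I_hi => 'C(size w + u - d, size w))) /=; first last.
- by move=> u _; congr 'C(_, _); have := ltn_ord u; lia.
- by move=> u; have := ltn_ord u; have := leq_b1 (x <= p); rewrite -/b; lia.
rewrite -(big_ord_widen hi (fun u => 'C(size w + u - d, size w))); last by lia.
rewrite hockey_stick //; congr 'C(_, _).
have : b <= 1 by rewrite leq_b1.
lia.
Qed.

(** A letter 0 put in front of a positive letter adds no descent, so 0 is a neutral start for
    [card_lex_chains]. *)
Lemma count_descents (w : seq nat) : all (fun x => 0 < x) w ->
  size (descent_set w) = count id (pairmap geq 0 w).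
Proof.
case: w => [|x w] //= /andP[x_gt0 _].
rewrite leqNgt x_gt0 add0n /descent_set size_filter /= -(addn0 1) iotaDl count_map.
elim: w x {x_gt0} => [|y w IHw] x //=; congr (_ + _).
by rewrite -(IHw y) -(addn0 1) iotaDl count_map.
Qed.

(** * Lists sorted by a strict order *)

Lemma filter_downward_closed (T : eqType) (lt : rel T) (p : pred T) (s : seq T) :
  transitive lt -> (forall x y, lt x y -> p y -> p x) -> sorted lt s ->
  filter p s = take (count p s) s.
Proof.
move=> lt_tr p_down; elim: s => [|x s IHs] //= path_xs.
case: ifP => px /=; first by rewrite {1}IHs ?(path_sorted path_xs).
have no_p : ~~ has p s.
  rewrite -all_predC; apply: sub_all (order_path_min lt_tr path_xs) => y ltxy /=.
  by apply: contraFN px => /(p_down _ _ ltxy).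
move: (no_p); rewrite has_filter negbK => /eqP->.
by move: no_p; rewrite has_count -eqn0Ngt => /eqP->.
Qed.

Lemma sorted_enumeration (T : finType) (lt : rel T) (S : {set T}) :
  transitive lt -> irreflexive lt -> (forall x y, [|| x == y, lt x y | lt y x]) ->
  exists2 t : seq T, sorted lt t & [set x in t] = S /\ size t = #|S|.
Proof.
move=> lt_tr lt_irr lt_tot; pose le x y := (x == y) || lt x y.
have le_tot : total le.
  by move=> x y; move: (lt_tot x y); rewrite /le => /or3P[]->; rewrite ?orbT.
have le_tr : transitive le.
  move=> y x z /orP[/eqP->//|ltxy] /orP[/eqP<-|ltyz]; first by rewrite /le ltxy orbT.
  by rewrite /le (lt_tr _ _ _ ltxy ltyz) orbT.
exists (sort le (enum S)); last first.
  by split; [apply/setP=> x; rewrite inE mem_sort mem_enum | rewrite size_sort -cardE].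
apply: pairwise_sorted.
have := sort_sorted le_tot (enum S); rewrite sorted_pairwise //.
have : uniq (sort le (enum S)) by rewrite sort_uniq enum_uniq.
rewrite uniq_pairwise => neq_s le_s.
have : pairwise [rel x y | (x != y) && le x y] (sort le (enum S)).
  by rewrite pairwise_relI neq_s.
by apply: sub_pairwise => x y /=; rewrite /le; case: eqP.
Qed.

(** * Ballot sets and reverse Yamanouchi words *)

Section BallotSets.

Variables s n : nat.
Local Notation P := ('I_s * 'I_n.+1)%type.
Implicit Types (S : {set P}) (x y : P) (t : n.-tuple P).

Definition nat_pair x : nat * nat := (val x.1, val x.2).

(** For a tableau this counts the entries of row [i] below [v]: it is the column of [v] when [v]
    occurs in the row, and the row length when [v = s]. Both arguments are in [nat], so that row
    [n.+1] and the bound [s] are allowed. *)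
Definition rank_in S (i v : nat) : nat :=
  #|[set x in S | (x.1 < v) && (x.2 == i :> nat)]|.

(* [S] is the set of pairs (entry, row) of a tableau, rows being numbered from
   1; the last condition says that columns weakly increase. *)
Definition ballot_set S : bool :=
  [&& #|S| == n, [forall x in S, 0 < x.2]
    & [forall v : 'I_s.+1, forall i : 'I_n.+1,
         (0 < i) ==> (rank_in S i.+1 v <= rank_in S i v)]].

Lemma rank_in_gt S i v : n < i -> rank_in S i v = 0.
Proof.
move=> lt_ni; rewrite /rank_in eq_card0 // => x; rewrite !inE.
by apply/negP=> /and3P[_ _ /eqP x2]; have := ltn_ord x.2; lia.
Qed.

Lemma rank_in_le S i v v' : v <= v' -> rank_in S i v <= rank_in S i v'.
Proof.
move=> le_v; apply/subset_leq_card/subsetP=> x; rewrite !inE.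
by case/and3P=> -> /leq_trans->.
Qed.

Lemma rank_inS S (i : 'I_n.+1) (v : 'I_s) :
  rank_in S i v.+1 = rank_in S i v + ((v, i) \in S).
Proof.
rewrite /rank_in; case vi_S: (_ \in S); last first.
  rewrite addn0; apply: eq_card => x; rewrite !inE ltnS leq_eqVlt.
  case: eqP => // x1; case: eqP => x2; rewrite ?andbF // andbT.
  move: vi_S; rewrite (_ : (v, i) = x) => [->//|].
  by case: x x1 x2 => x1 x2 /= e1 e2; congr (_, _); apply: val_inj.
rewrite [RHS]addnC (_ : [set x in S | _] =
  (v, i) |: [set x in S | (x.1 < v) && (x.2 == i :> nat)]).
  by rewrite cardsU1 !inE /= ltnn andbF.
apply/setP=> -[x1 x2]; rewrite !inE /= xpair_eqE -!val_eqE /= ltnS leq_eqVlt.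
by case: eqP => [/val_inj->|_] //=; case: eqP => [/val_inj->|_]; rewrite ?andbF ?andbT.
Qed.

Lemma rank_in_inj S (i : 'I_n.+1) (v v' : 'I_s) :
  (v, i) \in S -> (v', i) \in S -> rank_in S i v = rank_in S i v' -> v = v'.
Proof.
move=> v_S v'_S eq_rk; apply/val_inj; case: (ltngtP v v') => // lt_v.
  by have := rank_in_le S i lt_v; rewrite rank_inS v_S; lia.
by have := rank_in_le S i lt_v; rewrite rank_inS v'_S; lia.
Qed.

(** A discrete intermediate value argument: the rank starts at 0 and grows by at most 1 with [v], so
    it equals [j] just before it first exceeds [j]. *)
Lemma exists_rank S (i : 'I_n.+1) j : j < rank_in S i s ->
  exists2 v : 'I_s, (v, i) \in S & rank_in S i v = j.
Proof.
move=> lt_j; have ex_v : exists v, j < rank_in S i v by exists s.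
case: (ex_minnP ex_v) => -[|v] rk_v min_v.
  move: rk_v; rewrite /rank_in eq_card0 // => x; rewrite !inE ltn0 /=.
  by rewrite andbF.
have le_vs : v < s by apply: min_v.
have := rank_inS S i (Ordinal le_vs); rewrite /= => rkS.
have : rank_in S i v <= j by rewrite leqNgt; apply/negP=> /min_v; rewrite ltnn.
exists (Ordinal le_vs) => /=; last by lia.
by move: rkS; case: (_ \in S) => //; lia.
Qed.

Lemma card_by_rows S : (forall x, x \in S -> 0 < x.2) ->
  #|S| = \sum_(r < n) rank_in S r.+1 s.
Proof.
move=> pos; rewrite -sum1_card (partition_big (fun x => x.2) xpredT) //=.
rewrite big_ord_recl big1 ?add0n => [|x /andP[/pos + /eqP x2]]; last by rewrite x2.
apply: eq_bigr => r _; rewrite sum1dep_card /rank_in; apply: eq_card => x.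
by rewrite !inE ltn_ord -val_eqE.
Qed.

Lemma ballot_rank_le S i j v :
  ballot_set S -> 0 < i -> i <= j -> v <= s -> rank_in S j v <= rank_in S i v.
Proof.
case/and3P=> _ _ /forallP rkS i_gt0 le_ij le_vs; rewrite -(subnKC le_ij).
elim: (j - i) => [|k IHk]; first by rewrite addn0.
apply: leq_trans IHk; rewrite addnS.
case: (leqP (i + k) n) => [le_n|lt_n]; last by rewrite rank_in_gt // ltnS ltnW.
have /forallP/(_ (inord (i + k)))/implyP := rkS (inord v).
by rewrite !inordK ?ltnS // addn_gt0 i_gt0; apply.
Qed.

Lemma rank_in_uniq t i v : uniq t ->
  rank_in [set x in t] i v = count (fun x => (x.1 < v) && (x.2 == i :> nat)) t.
Proof.
move=> t_uniq; rewrite -size_filter -(card_uniqP (filter_uniq _ t_uniq)).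
by apply: eq_card => x; rewrite !inE mem_filter andbC.
Qed.

(** The pairs with entry below [v] form a prefix of the sorted list, so the ballot inequalities are
    the Yamanouchi inequalities at these prefixes. The other prefixes cut a block of equal entries,
    and need a threshold adapted to the letter [i]. *)
Lemma ballot_set_yamanouchi t : sorted (relpre nat_pair lex_lt) t ->
  ballot_set [set x in t] = reverse_yamanouchi (map (fun x => val x.2) t).
Proof.
move=> t_sorted.
have lt_tr : transitive (relpre nat_pair lex_lt) by move=> y x z; apply: lex_lt_trans.
have t_uniq : uniq t.
  by apply: (sorted_uniq lt_tr) t_sorted => x; apply: lex_lt_irr.
apply/idP/reverse_yamanouchiP => [bal|[pos yam]].
  have /and3P[_ /forall_inP pos _] := bal; split.
    by move=> _ /mapP[x x_t ->]; apply: pos; rewrite inE.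
  move=> m i i_gt0; rewrite -map_take !count_map.
  (* The least threshold above all entries that carry the letter [i.+1] in the prefix; it is 0 if
     there are none. *)
  set u := take m t; pose v := \max_(x <- u | val x.2 == i.+1) x.1.+1.
  have le_vs : v <= s by apply/bigmax_leqP_seq=> x _ _; apply: ltn_ord.
  have := ballot_rank_le bal i_gt0 (leqnSn i) le_vs.
  rewrite !rank_in_uniq // -(cat_take_drop m t) -/u !count_cat => le_c.
  move: (t_sorted); rewrite (sorted_pairwise lt_tr) -(cat_take_drop m t) -/u.
  rewrite pairwise_cat => /andP[/allrelP lt_u _].
  (* Going from a letter [i.+1] in the prefix to a later [i] is a descent, so the entry rises
     strictly and is at least [v]. Hence every [i] with entry below [v] lies in the prefix. *)
  have no_drop : count (fun x => (x.1 < v) && (x.2 == i :> nat)) (drop m t) = 0.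
    apply/eqP; rewrite -leqn0 leqNgt -has_count; apply/hasPn=> y y_drop.
    apply/negP=> /andP[lt_v /eqP y2]; move: lt_v; rewrite ltnNge => /negP[].
    apply/bigmax_leqP_seq=> x x_u /eqP x2.
    have := lt_u _ _ x_u y_drop; rewrite /= in x2 *; by rewrite /lex_lt /= x2 y2 leqnSn addn1.
  rewrite no_drop addn0 in le_c.
  apply: leq_trans (leq_trans (leq_trans _ (leq_addr _ _)) le_c) _.
    rewrite -!size_filter (eq_in_filter (a2 := fun x => (x.1 < v) && (x.2 == i.+1 :> nat))) //.
    move=> x x_u /=; case: eqP => [x2|_]; rewrite ?andbF // andbT.
    by apply/esym; apply: (@leq_bigmax_seq _ u _ (fun x : P => x.1.+1)) => //; apply/eqP.
  by apply: sub_count => x /andP[_].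
rewrite /ballot_set cardsE (card_uniqP t_uniq) size_tuple eqxx /=.
apply/andP; split.
  by apply/forall_inP=> x; rewrite inE => x_t; apply/pos/map_f.
apply/forallP=> v; apply/forallP=> i; apply/implyP=> i_gt0.
rewrite !rank_in_uniq //.
have count_v j : count (fun x => (x.1 < v) && (x.2 == j :> nat)) t =
    count_mem j (take (count (fun x : P => x.1 < v) t) (map (fun x => val x.2) t)).
  rewrite -map_take count_map -(filter_downward_closed lt_tr) //.
    by rewrite count_filter; apply: eq_count => x /=; rewrite andbC.
  by move=> x y; rewrite /= /lex_lt /=; lia.
by rewrite !count_v yam.
Qed.

Lemma card_ballot_sets :
  #|[set S | ballot_set S]| =
  #|[set t : n.-tuple P | sorted (relpre nat_pair lex_lt) t &&
      reverse_yamanouchi (map (fun x => val x.2) t)]|.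
Proof.
have lt_tr : transitive (relpre nat_pair lex_lt) by move=> y x z; apply: lex_lt_trans.
have lt_irr : irreflexive (relpre nat_pair lex_lt) by move=> x; apply: lex_lt_irr.
rewrite -(card_in_imset (f := fun t : n.-tuple P => [set x in t])); last first.
  move=> t u; rewrite !inE => /andP[t_sorted _] /andP[u_sorted _] /setP eq_tu.
  apply/val_inj/(irr_sorted_eq lt_tr lt_irr) => // x.
  by have := eq_tu x; rewrite !inE.
apply: eq_card => S; rewrite inE; apply/idP/imsetP => [bal|[t]]; last first.
  by rewrite inE => /andP[t_sorted yam] ->; rewrite ballot_set_yamanouchi.
have lt_tot x y : [|| x == y, relpre nat_pair lex_lt x y | relpre nat_pair lex_lt y x].
  case: x y => [x1 x2] [y1 y2]; rewrite xpair_eqE /lex_lt /= -!val_eqE /=; lia.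
have [t t_sorted [tS /eqP t_size]] := sorted_enumeration S lt_tr lt_irr lt_tot.
have /and3P[/eqP S_n _ _] := bal; rewrite S_n in t_size.
exists (Tuple t_size); rewrite // inE t_sorted -ballot_set_yamanouchi //=.
by rewrite tS.
Qed.

Lemma card_lex_sorted_tuples :
  #|[set t : n.-tuple P | sorted (relpre nat_pair lex_lt) t &&
      reverse_yamanouchi (map (fun x => val x.2) t)]| =
  \sum_(w : n.-tuple 'I_n.+1 | reverse_yamanouchi (map val w))
     \sum_(c : n.-tuple 'I_s) path lex_lt (0, 0) (zip (map val c) (map val w)).
Proof.
pose split_tuple (p : n.-tuple 'I_n.+1 * n.-tuple 'I_s) : n.-tuple P :=
  [tuple of zip p.2 p.1].
rewrite -sum1dep_card pair_big /= big_mkcond /= (reindex split_tuple) /=; last first.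
  exists (fun t : n.-tuple P => ([tuple of map snd t], [tuple of map fst t])).
    move=> [w c] _; congr (_, _); apply: val_inj => /=.
      by rewrite -/(unzip2 _) unzip2_zip ?size_tuple.
    by rewrite -/(unzip1 _) unzip1_zip ?size_tuple.
  by move=> t _; apply: val_inj; rewrite /= zip_unzip.
rewrite [RHS]big_mkcond; apply: eq_bigr => -[w c] _ /=.
have -> : map (fun x : P => val x.2) (zip c w) = map val w.
  rewrite (map_comp val snd) -/(unzip2 _) unzip2_zip ?size_tuple //.
case yam: (reverse_yamanouchi _); rewrite ?andbF // !andbT.
have zipE : zip (map val c) (map val w) = map nat_pair (zip c w).
  move: (val c) (val w) => a b {yam}; elim: a b => [|x a IHa] [|y b] //=.
  by rewrite IHa.
have /reverse_yamanouchiP[pos _] := yam.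
rewrite zipE -sorted_map -zipE.
move: pos (map val c) => {yam zipE}; case: (map val w) => [|y b] pos [|x a] //=.
(* The initial pair [(0, 0)] imposes nothing, since the first letter is positive. *)
have y_gt0 : 0 < y by apply: pos; rewrite inE eqxx.
by rewrite /lex_lt /= (leqNgt y) y_gt0; case: path.
Qed.

End BallotSets.

(** * Tableaux of a fixed shape as ballot sets *)

Section Encoding.

Variables (n s : nat) (la : {ffun 'I_n -> 'I_n.+1}).
Hypothesis la_part : is_partition la.
Implicit Types (T : {ffun cell la -> 'I_s}) (r j : 'I_n) (c d : cell la).

Lemma cell_exists r j : j < la r -> exists c, val c = (r, j).
Proof.
move=> lt_j; have rj : (r, j) \in diagram la by rewrite inE.
by exists (Sub (r, j) rj).
Qed.

(* Positions outside the diagram get the value [s], larger than any symbol. *)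
Definition entry T r j : nat :=
  if insub (r, j) : option (cell la) is Some c then val (T c) else s.

Lemma entry_cell T c : entry T (val c).1 (val c).2 = T c.
Proof. by rewrite /entry -surjective_pairing valK. Qed.

Lemma entry_out T r j : la r <= j -> entry T r j = s.
Proof. by move=> le_j; rewrite /entry insubN // inE -leqNgt. Qed.

Lemma entry_lt T r j : (entry T r j < s) = (j < la r).
Proof.
case: (ltnP j (la r)) => [/cell_exists[c def_c]|le_j]; last by rewrite entry_out ?ltnn.
by have := entry_cell T c; rewrite def_c /= => ->; apply: ltn_ord.
Qed.

Lemma entry_row T r j j' : semistandard T ->
  j < j' -> j < la r -> entry T r j < entry T r j'.
Proof.
move=> ssT lt_j jr; case: (ltnP j' (la r)) => [|/(entry_out T) ->]; last by rewrite entry_lt.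
case/cell_exists=> d def_d; case/cell_exists: jr => c def_c.
have := entry_cell T c; have := entry_cell T d; rewrite def_c def_d /= => -> ->.
have /forallP/(_ c)/forallP/(_ d)/andP[/implyP + _] := ssT; apply.
by rewrite def_c def_d eqxx.
Qed.

(** The default value [s] extends the inequality to the whole grid: if the lower position is in the
    diagram, so is the upper one, because [la] is decreasing. *)
Lemma entry_col T r r' j : semistandard T ->
  r <= r' -> entry T r j <= entry T r' j.
Proof.
move=> ssT; rewrite leq_eqVlt => /predU1P[/val_inj->//|lt_r].
case: (ltnP j (la r')) => [jr'|/(entry_out T) ->]; last first.
  by rewrite /entry; case: insubP => // c _ _; apply/ltnW/ltn_ord.
have jr : j < la r.
  have /andP[/forallP/(_ r)/forallP/(_ r')/implyP le_la _] := la_part.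
  by apply: leq_trans jr' (le_la (ltnW lt_r)).
case/cell_exists: jr => c def_c; case/cell_exists: jr' => d def_d.
have := entry_cell T c; have := entry_cell T d; rewrite def_c def_d /= => -> ->.
have /forallP/(_ c)/forallP/(_ d)/andP[_ /implyP] := ssT; apply.
by rewrite def_c def_d eqxx.
Qed.

(** [lift ord0] numbers the rows from 1, so that they become positive letters. *)
Definition entry_row_pair T c : 'I_s * 'I_n.+1 := (T c, lift ord0 (val c).1).

Definition encode T : {set 'I_s * 'I_n.+1} := entry_row_pair T @: setT.

Lemma entry_row_pair_inj T : semistandard T -> injective (entry_row_pair T).
Proof.
move=> ssT c d eq_cd; have eqT : T c = T d := congr1 fst eq_cd.
have eq_r : (val c).1 = (val d).1 := lift_inj (congr1 snd eq_cd).
have ss := forallP (forallP ssT _) _.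
apply/val_inj; rewrite (surjective_pairing (val c)) (surjective_pairing (val d)).
congr (_, _) => //; apply/val_inj; case: (ltngtP (val c).2 (val d).2) => // lt_j.
  by have /andP[/implyP + _] := ss c d; rewrite eq_r eqxx lt_j eqT ltnn => /(_ isT).
by have /andP[/implyP + _] := ss d c; rewrite eq_r eqxx lt_j eqT ltnn => /(_ isT).
Qed.

(** The bound [v <= s] keeps positions outside the diagram out of the count. *)
Lemma rank_encode T r v : semistandard T -> v <= s ->
  rank_in (encode T) r.+1 v = #|[set j | entry T r j < v]|.
Proof.
move=> ssT le_vs; pose C := [set c | ((val c).1 == r) && (T c < v)].
transitivity #|C|.
  rewrite -(card_imset C (entry_row_pair_inj ssT)); apply: eq_card => x.
  rewrite !inE; apply/and3P/imsetP => [[/imsetP[c _ ->] /= lt_v /eqP eq_r]|[c]].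
    exists c => //; rewrite inE lt_v andbT; apply/eqP/val_inj.
    by move: eq_r; rewrite /bump /= add1n => -[].
  rewrite inE => /andP[/eqP eq_r lt_v] -> /=; split=> //.
    by apply: imset_f.
  by rewrite /bump add1n eq_r.
rewrite -(card_in_imset (f := fun c => (val c).2) (D := C)); last first.
  move=> c d; rewrite !inE => /andP[/eqP rc _] /andP[/eqP rd _] eq2; apply/val_inj.
  by rewrite (surjective_pairing (val c)) (surjective_pairing (val d)) rc rd eq2.
apply: eq_card => j; rewrite inE; apply/imsetP/idP => [[c]|lt_v].
  by rewrite inE => /andP[/eqP <- lt_v] ->; rewrite entry_cell.
have := leq_trans lt_v le_vs; rewrite entry_lt => /cell_exists[c def_c].
exists c; rewrite ?def_c // inE def_c eqxx /=.
by rewrite -entry_cell def_c.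
Qed.

Lemma card_ltn_ord m : m <= n -> #|[set j : 'I_n | j < m]| = m.
Proof.
move=> le_mn; rewrite -sum1dep_card -(big_ord_widen n (fun=> 1)) //.
by rewrite sum1_card card_ord.
Qed.

Lemma rank_encode_shape T r : semistandard T -> rank_in (encode T) r.+1 s = la r.
Proof.
move=> ssT; rewrite rank_encode // -[RHS]card_ltn_ord -1?ltnS //.
by apply: eq_card => j; rewrite !inE entry_lt.
Qed.

(** As rows are strict, the smaller entries of the row are those to the left of [c]. The encoding
    thus remembers columns. *)
Lemma rank_encode_cell T c : semistandard T ->
  rank_in (encode T) (val c).1.+1 (T c) = (val c).2.
Proof.
move=> ssT; rewrite rank_encode //; last exact/ltnW/ltn_ord.
rewrite -[RHS]card_ltn_ord; last exact/ltnW/ltn_ord.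
have lt_c : (val c).2 < la (val c).1 by have := valP c; rewrite inE.
apply: eq_card => j; rewrite !inE -entry_cell.
case: (ltngtP j (val c).2) => [lt_j|lt_j|/val_inj->]; last by rewrite ltnn.
  by rewrite entry_row // (ltn_trans lt_j).
by rewrite ltnNge ltnW // entry_row.
Qed.

Lemma encode_ballot T : semistandard T -> ballot_set (encode T).
Proof.
move=> ssT.
have pos x : x \in encode T -> 0 < x.2 by case/imsetP=> c _ ->.
apply/and3P; split; last 1 first.
- apply/forallP=> v; apply/forallP=> i; apply/implyP=> i_gt0.
  (* For [i = n] the row [i.+1] is empty. Otherwise the column inequality gives an inclusion of the
     two sets of columns. *)
  case: (ltnP i n) => [lt_in|le_ni]; last by rewrite rank_in_gt.
  have lt_i1 : i.-1 < n by rewrite (leq_ltn_trans (leq_pred _)).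
  have le_v : v <= s by rewrite -ltnS.
  rewrite (rank_encode (Ordinal lt_in)) // -{2}(prednK i_gt0).
  rewrite (rank_encode (Ordinal lt_i1)) //; apply/subset_leq_card/subsetP=> j.
  by rewrite !inE; apply/leq_ltn_trans/entry_col => //=; apply: leq_pred.
- rewrite (card_by_rows pos) (eq_bigr (fun r => val (la r))).
    by have /andP[] := la_part.
  by move=> r _; rewrite rank_encode_shape.
- exact/forall_inP.
Qed.

Lemma encode_inj : {in [pred T | semistandard T] &, injective encode}.
Proof.
move=> T T'; rewrite !inE => ssT ssT' eqE; apply/ffunP=> c.
apply: (@rank_in_inj s n (encode T) (lift ord0 (val c).1)).
- exact: (imset_f (entry_row_pair T)).
- by rewrite eqE; apply: (imset_f (entry_row_pair T')).
- rewrite lift0; transitivity (val (val c).2 : nat); first exact: rank_encode_cell.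
  by rewrite eqE rank_encode_cell.
Qed.

(** The cell in column [j] of a row receives the element of rank [j] in that row of [S]. *)
Lemma encode_surj (S : {set 'I_s * 'I_n.+1}) : ballot_set S ->
  (forall r, rank_in S r.+1 s = la r) -> exists2 T, semistandard T & encode T = S.
Proof.
move=> bal shapeS.
have ex_v c : exists v : 'I_s, (v, lift ord0 (val c).1) \in S /\
    rank_in S (val c).1.+1 v = (val c).2.
  have [|v vS rk_v] := @exists_rank s n S (lift ord0 (val c).1) (val c).2.
    by rewrite lift0 shapeS; have := valP c; rewrite inE.
  by exists v; split; rewrite // -rk_v lift0.
have [f fP] := fin_all_exists ex_v.
pose T := [ffun c => f c].
have T_S c : (T c, lift ord0 (val c).1) \in S by rewrite ffunE; case: (fP c).
have rkT c : rank_in S (val c).1.+1 (T c) = (val c).2 by rewrite ffunE; case: (fP c).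
have ssT : semistandard T.
  apply/forallP=> c; apply/forallP=> d; apply/andP; split; apply/implyP.
    case/andP=> /eqP eq_r lt_j; rewrite ltnNge; apply: contraL lt_j => le_T.
    by rewrite -leqNgt -(rkT c) -(rkT d) eq_r rank_in_le.
  (* If the lower entry [T d] were smaller than [T c], the lower row would have more than
     [(val c).2] elements below [T c], and the upper row exactly that many, against the ballot
     condition. *)
  case/andP=> /eqP eq_j lt_r; rewrite leqNgt; apply/negP=> lt_T.
  have := rank_in_le S (lift ord0 (val d).1) lt_T.
  rewrite rank_inS T_S addn1 lift0 rkT -eq_j -(rkT c) ltnNge => /negP[].
  by apply: ballot_rank_le => //; [apply: ltnW | apply/ltnW/ltn_ord].
(* The encoding is contained in [S], and both have [n] elements. *)
exists T => //; apply/eqP; rewrite eqEcard; apply/andP; split.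
  by apply/subsetP=> _ /imsetP[c _ ->]; apply: T_S.
have /and3P[/eqP-> _ _] := encode_ballot ssT.
by have /and3P[/eqP-> _ _] := bal.
Qed.

End Encoding.

(** * Sum over all shapes and the first formula *)

Definition shape_of (n s : nat) (S : {set 'I_s * 'I_n.+1}) : {ffun 'I_n -> 'I_n.+1} :=
  [ffun r : 'I_n => inord (rank_in S r.+1 s)].

Lemma shape_ofE n s (S : {set 'I_s * 'I_n.+1}) (r : 'I_n) : ballot_set S ->
  shape_of S r = rank_in S r.+1 s :> nat.
Proof.
case/and3P=> /eqP cardS _ _; rewrite ffunE inordK // ltnS -[X in _ <= X]cardS.
by apply/subset_leq_card/subsetP=> x; rewrite inE => /andP[].
Qed.

Lemma shape_of_partition n s (S : {set 'I_s * 'I_n.+1}) :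
  ballot_set S -> is_partition (shape_of S).
Proof.
move=> bal; apply/andP; split.
  apply/forallP=> i; apply/forallP=> j; apply/implyP=> le_ij.
  by rewrite !shape_ofE //; apply: ballot_rank_le.
have /and3P[/eqP cardS /forall_inP pos _] := bal.
rewrite (eq_bigr _ (fun r _ => shape_ofE r bal)) -card_by_rows //.
exact/eqP.
Qed.

(** Ballot sets are sorted by shape; on each shape [encode] is a bijection. *)
Lemma num_ssyt_ballot n s : num_ssyt n s = #|[set S : {set 'I_s * 'I_n.+1} | ballot_set S]|.
Proof.
rewrite -sum1dep_card (partition_big _ _ (@shape_of_partition n s)) /num_ssyt.
apply: eq_bigr => la la_part; rewrite sum1dep_card -(card_in_imset (f := @encode n s la)).
  apply: eq_card => S; rewrite inE; apply/imsetP/andP => [[T]|[bal /eqP shapeS]].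
    rewrite inE => ssT ->; have bal := encode_ballot la_part ssT; split=> //.
    by apply/eqP/ffunP=> r; apply/val_inj; rewrite /= shape_ofE // rank_encode_shape.
  have [|T ssT <-] := @encode_surj n s la la_part S bal.
    by move=> r; rewrite -shape_ofE // shapeS.
  by exists T; rewrite ?inE.
by move=> T T'; rewrite !inE; apply: encode_inj.
Qed.

Lemma num_ssyt_sum n s : (1 <= s)%N ->
  num_ssyt n s = \sum_(0 <= k < s) 'C(n + k, k) * num_yamanouchi n (s - k - 1).
Proof.
move=> s_gt0; rewrite num_ssyt_ballot card_ballot_sets card_lex_sorted_tuples.
pose des (w : n.-tuple 'I_n.+1) := size (descent_set (map val w)).
(* The binomial attached to [w] is written as a sum over [k] with one nonzero term at most, so that
   the two sums can be exchanged. *)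
transitivity (\sum_(w : n.-tuple 'I_n.+1 | reverse_yamanouchi (map val w))
  \sum_(0 <= k < s) 'C(n + k, k) * (des w == s - k - 1)).
  apply: eq_bigr => w yam.
  have /andP[pos _] := yam; have := count_descents pos; rewrite -/(des w) => desE.
  have size_w : size (map val w) = n by rewrite size_map size_tuple.
  have := card_lex_chains (map val w) 0 s_gt0; rewrite -desE size_w => ->.
  have [lt_d|le_d] := ltnP (des w) s; last first.
    (* With [0 < s <= des w] this makes [n] positive; for [n = 0] the truncated binomial would be 1
       instead of 0. *)
    have le_dn : des w <= n.
      by rewrite desE -[X in _ <= X]size_w -(size_pairmap geq 0) count_size.
    rewrite bin_small; last by lia.
    rewrite big_nat big1 // => k /andP[_ lt_k]; case: eqP => [|_]; [lia|by rewrite muln0].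
  (* The index [k] with [s - k - 1 = des w]. *)
  have lt_k : s - 1 - des w < s by lia.
  rewrite big_mkord (bigD1 (Ordinal lt_k)) //= big1 => [|k].
    rewrite addn0 (_ : _ == _ = true) ?muln1; last by apply/eqP; lia.
    rewrite -[in RHS]bin_sub ?leq_addl // addnK; congr 'C(_, _); lia.
  rewrite -val_eqE /= => neq_k; case: eqP => [|_]; [|by rewrite muln0].
  have := ltn_ord k; lia.
rewrite exchange_big; apply: eq_bigr => k _ /=; rewrite -big_distrr /=; congr (_ * _).
rewrite /num_yamanouchi -sum1dep_card [RHS]big_mkcondr /=.
by apply: eq_bigr => w _; rewrite -/(des w); case: eqP.
Qed.

(** * Binomial inversion and the second formula *)

Section Inversion.

Import GRing.Theory.
Local Open Scope ring_scope.

Definition alternating_sum (N : nat) (f : nat -> int) (k : nat) : int :=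
  \sum_(i < k.+1) (-1) ^+ i * ('C(N, i))%:Z * f (k - i)%N.

(** For [N = 0] the truncated predecessor leaves only the term [l = 0], with coefficient 1, and the
    operator is the identity. *)
Definition iterated_sum (N : nat) (f : nat -> int) (k : nat) : int :=
  \sum_(l < k.+1) ('C((N + l).-1, l))%:Z * f (k - l)%N.

Lemma alternating_sumS N f k :
  alternating_sum N.+1 f k =
  alternating_sum N f k - (if k is k'.+1 then alternating_sum N f k' else 0).
Proof.
rewrite /alternating_sum; case: k => [|k].
  by rewrite !big_ord_recl !big_ord0 ?bin0 ?subr0.
rewrite big_ord_recl [X in X - _]big_ord_recl /= !bin0 -addrA; congr (_ + _).
rewrite -sumrB; apply: eq_bigr => i _.
rewrite /bump /= add1n subSS binS PoszD exprS.
by rewrite mulrDr mulrDl !mulN1r !mulNr.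
Qed.

(** A backward difference undoes one summation, by Pascal's rule. *)
Lemma iterated_sumS N f k :
  iterated_sum N.+1 f k - (if k is k'.+1 then iterated_sum N.+1 f k' else 0) =
  iterated_sum N f k.
Proof.
rewrite /iterated_sum; case: k => [|k].
  by rewrite !big_ord_recl !big_ord0 ?bin0 ?subr0.
rewrite big_ord_recl [RHS]big_ord_recl /= !bin0 -addrA; congr (_ + _).
rewrite -sumrB; apply: eq_bigr => i _.
rewrite /bump /= add1n subSS addnS /= binS PoszD.
by rewrite mulrDl addrK.
Qed.

(* On generating functions the two operators are multiplication by (1 - x)^N
   and by (1 - x)^-N. *)
Lemma alternating_sumK N f k : alternating_sum N (iterated_sum N f) k = f k.
Proof.
elim: N f k => [|N IHN] f k.
  rewrite /alternating_sum big_ord_recl big1 => [|i _]; last by rewrite bin0n mulr0 mul0r.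
  rewrite subn0 /iterated_sum big_ord_recl big1 => [|i _]; last first.
    by rewrite lift0 bin_small ?mul0r.
  by rewrite !bin0 !addr0 !mul1r subn0.
rewrite alternating_sumS -[RHS](IHN f k).
(* The extra difference is moved inside, where it lowers [N.+1] to [N]. *)
have -> : alternating_sum N (iterated_sum N f) k =
   alternating_sum N (fun j => iterated_sum N.+1 f j -
     (if j is j'.+1 then iterated_sum N.+1 f j' else 0)) k.
  by apply: eq_bigr => i _; rewrite iterated_sumS.
rewrite /alternating_sum.
under [RHS]eq_bigr do rewrite mulrBr.
rewrite sumrB; congr (_ - _).
case: k => [|k]; first by rewrite big_ord_recl big_ord0 mulr0 addr0.
(* The last term evaluates the shifted sequence at 0, where it is 0. *)
rewrite [RHS]big_ord_recr /= subnn mulr0 addr0; apply: eq_bigr => i _.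
by rewrite subSn // -ltnS.
Qed.

End Inversion.

Theorem theorem3 :
  (forall n s : nat, (1 <= s)%N ->
     num_ssyt n s =
       (\sum_(0 <= k < s) 'C(n + k, k) * num_yamanouchi n (s - k - 1))%N)
  /\
  (forall n k : nat,
     ((num_yamanouchi n k)%:Z =
       \sum_(1 <= j < k.+2)
          (-1) ^+ (k.+1 - j) * ('C(n.+1, k.+1 - j))%:Z * (num_ssyt n j)%:Z)%R).
Proof.
split=> [|n k]; first exact: num_ssyt_sum.
rewrite -(alternating_sumK n.+1 (fun m => Posz (num_yamanouchi n m))).
rewrite big_add1 big_mkord (reindex_inj rev_ord_inj); apply: eq_bigr => i _ /=.
have le_ik : i <= k by rewrite -ltnS.
rewrite !subSS subKn //; congr (_ * _)%R.
(* By the first formula with [s = (k - i).+1], the tableau count is [iterated_sum n.+1] of the word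
   counts at [k - i]. *)
rewrite num_ssyt_sum // big_mkord (big_morph Posz PoszD (erefl _)).
apply: eq_bigr => l _; rewrite PoszM addSn /=; congr (_ * Posz (num_yamanouchi n _))%R.
by lia.
Qed.
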